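(* Let $k\ge1$ be an integer and let $F:\mathcal{U}\to\mathbb{C}^4$ be continuous with $F(\mathcal{U})\subseteq\Omega$. If $TF=F$ (i.e. $F$ is a stem function), then there exist $k$ (pairwise distinct) continuous functions $G:\mathcal{U}\to\mathbb{C}^4$ such that $$\sigma_k\circ G=F,\qquad TG=G.$$
   Context: Standing assumption: $\mathcal{U}\subset\mathbb{C}$ is either a simply connected (connected) open domain invariant under complex conjugation, or the union of two disjoint simply connected open domains exchanged by complex conjugation. For $G:\mathcal{U}\to\mathbb{C}^4$, $TG:\mathcal{U}\to\mathbb{C}^4$ is defined by $TG(z)=\overline{G(\overline z)}$ (componentwise conjugation). Points of $\mathbb{C}^4$ are written $z=(z_0,\underline{z})$ with $\underline{z}=(z_1,z_2,z_3)$, and $\underline{z}^2:=z_1^2+z_2^2+z_3^2\in\mathbb{C}$. For an integer $k\ge1$, $p_0^k$ and $p_1^{k-1}$ are the two-variable integer polynomials determined by $(x+\imath y)^k=p_0^k(x,y^2)+\imath\, y\,p_1^{k-1}(x,y^2)$ for $x,y\in\mathbb{R}$, and $\sigma_k:\mathbb{C}^4\to\mathbb{C}^4$ is $$\sigma_k(z_0,\underline{z})=\big(p_0^k(z_0,\underline{z}^2),\ p_1^{k-1}(z_0,\underline{z}^2)\,\underline{z}\big)$$ (the $k$-th power map of the algebra $\mathbb{C}\otimes_{\mathbb{R}}\mathbb{H}\cong\mathbb{C}^4$). Put $$\Omega=\{(z_0,\underline{z})\in\mathbb{C}^4:\ \underline{z}^2\ne0,\ z_0^2+\underline{z}^2\neq0,\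 z_0\neq0\}.$$ *)

(* Defs.v *)
From HB Require Import structures.
From mathcomp Require Import all_boot all_order all_algebra.
From mathcomp Require Import all_classical all_reals all_analysis.
From mathcomp Require Import complex ring.

Set Implicit Arguments.
Unset Strict Implicit.
Unset Printing Implicit Defensive.

Import Order.TTheory GRing.Theory Num.Theory numFieldNormedType.Exports.
Local Open Scope classical_set_scope.
Local Open Scope ring_scope.

(* The usual topology of the complex plane: the one of the modulus, which is
   the norm that [R[i]] already carries as a numeric field. *)
HB.instance Definition _ (R : rcfType) := NormedModule.copy R[i] R[i]^o.

Section Plane.
Variable R : realType.
Implicit Types (U : set R[i]) (g : R -> R[i]).

(* Paths are functions on the whole of R of which only the restriction to
   [0, 1] matters. *)
Definition path_in U g : Prop :=
  {within `[0, 1], continuous g} /\ (forall t, 0 <= t <= 1 -> U (g t)).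

Definition path_connected U : Prop :=
  forall a b, U a -> U b -> exists2 g, path_in U g & g 0 = a /\ g 1 = b.

(* Endpoint-preserving homotopy in [U] from the loop [g] to the constant loop;
   the first variable is the homotopy parameter. *)
Definition null_homotopic U g : Prop :=
  exists H : R * R -> R[i],
    [/\ {within `[0, 1] `*` `[0, 1], continuous H},
        (forall s t, 0 <= s <= 1 -> 0 <= t <= 1 -> U (H (s, t))),
        (forall t, 0 <= t <= 1 -> H (0, t) = g t /\ H (1, t) = g 0) &
        (forall s, 0 <= s <= 1 -> H (s, 0) = g 0 /\ H (s, 1) = g 0)].

Definition simply_connected U : Prop :=
  path_connected U /\
  (forall g, path_in U g -> g 0 = g 1 -> null_homotopic U g).

Definition simply_connected_domain U : Prop :=
  [/\ U !=set0, open U, connected U & simply_connected U].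

Definition conj_set U : set R[i] := [set z^* | z in U].

Definition admissible_domain U : Prop :=
  (simply_connected_domain U /\ conj_set U = U) \/
  (exists A B : set R[i],
     [/\ simply_connected_domain A, simply_connected_domain B,
         A `&` B = set0, conj_set A = B & U = A `|` B]).

End Plane.

Section PowerPolynomials.

(* The pair (p_0^k, p_1^(k-1)) of integer polynomials in two variables x, t,
   where x is the outer variable 'X and t is the inner one 'X%:P. The recursion
   is multiplication by x + iy with t = y^2; see [pow_polysP] and
   [pow_polys_unique] for the defining property. *)
Fixpoint pow_polys (k : nat) : {poly {poly int}} * {poly {poly int}} :=
  if k is k'.+1 then
    let p := pow_polys k' in ('X * p.1 - 'X%:P * p.2, p.1 + 'X * p.2)
  else (1, 0).

Definition eval2 (A : comNzRingType) (p : {poly {poly int}}) (x t : A) : A :=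
  (map_poly (map_poly (intr : int -> A)) p).[x%:P].[t].

Definition pow_re (k : nat) : {poly {poly int}} := (pow_polys k).1.
Definition pow_im (k : nat) : {poly {poly int}} := (pow_polys k).2.

Lemma pow_re_eval (A : comNzRingType) k (x t : A) :
  eval2 (pow_re k.+1) x t = x * eval2 (pow_re k) x t - t * eval2 (pow_im k) x t.
Proof.
by rewrite /eval2 /pow_re /= rmorphB !rmorphM /= map_polyX map_polyC /=
  map_polyX !hornerE.
Qed.

Lemma pow_im_eval (A : comNzRingType) k (x t : A) :
  eval2 (pow_im k.+1) x t = eval2 (pow_re k) x t + x * eval2 (pow_im k) x t.
Proof.
by rewrite /eval2 /pow_im /= rmorphD !rmorphM /= map_polyX !hornerE.
Qed.

Definition pow_identity (R : realType) (k : nat) (p q : {poly {poly int}}) :=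
  forall x y : R,
    (Complex x y) ^+ k = Complex (eval2 p x (y ^+ 2)) (y * eval2 q x (y ^+ 2)).

Lemma pow_polysP (R : realType) k : pow_identity R k (pow_re k) (pow_im k).
Proof.
move=> x y; elim: k => [|k IH].
  rewrite expr0 /eval2 /pow_re /pow_im /= rmorph1 rmorph0 !hornerE.
  by [].
rewrite exprS IH pow_re_eval pow_im_eval.
apply/eqP; rewrite eq_complex /=; apply/andP; split; apply/eqP; ring.
Qed.

Lemma poly_eq0_pos (R : realType) (p : {poly R}) :
  (forall t, 0 < t -> p.[t] = 0) -> p = 0.
Proof.
move=> h; apply/eqP/negPn/negP => p0.
have := @max_poly_roots _ p [seq (i.+1)%:R | i <- iota 0 (size p)] p0.
rewrite size_map size_iota ltnn => F; suff: false by []; apply: F.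
  by apply/allP => _ /mapP[i _ ->]; rewrite /root h // ltr0n.
rewrite map_inj_uniq ?iota_uniq // => i j /eqP.
by rewrite eqr_nat => /eqP[].
Qed.

Lemma eval2_inj (R : realType) (p q : {poly {poly int}}) :
  (forall x y : R, y != 0 -> eval2 p x (y ^+ 2) = eval2 q x (y ^+ 2)) -> p = q.
Proof.
move=> h; apply/eqP; rewrite -subr_eq0; apply/eqP.
set d := p - q.
have hd (x t : R) : 0 < t -> eval2 d x t = 0.
  move=> t0; have s0 : Num.sqrt t != 0 by rewrite gt_eqF // sqrtr_gt0.
  have := h x _ s0; rewrite sqr_sqrtr ?ltW // /eval2 /d rmorphB !hornerE => ->.
  by rewrite subrr.
apply/polyP => i; rewrite coef0.
suff : map_poly (intr : int -> R) d`_i = 0.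
  move/polyP => e; apply/polyP => j; move: (e j).
  by rewrite coef_map !coef0 /= => /eqP; rewrite intr_eq0 => /eqP.
apply: poly_eq0_pos => t t0.
set Q := map_poly (map_poly (intr : int -> R)) d.
have : map_poly (horner_eval t) Q = 0.
  apply: poly_eq0_pos => x _.
  by rewrite -[x](hornerC x t) -[LHS]/((map_poly _ Q).[horner_eval t x%:P])
    horner_map; exact: hd.
by move/polyP/(_ i); rewrite coef_map coef0 /Q coef_map.
Qed.

Lemma pow_polys_unique (R : realType) k (p q : {poly {poly int}}) :
  pow_identity R k p q -> p = pow_re k /\ q = pow_im k.
Proof.
move=> h; split; apply: (@eval2_inj R) => x y y0.
  by have := h x y; rewrite pow_polysP => -[-> _].
by have := h x y; rewrite pow_polysP => -[_ /(mulfI y0)].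
Qed.

End PowerPolynomials.

(* The splitting 1 + 3 is the decomposition z = (z_0, (z_1, z_2, z_3)). *)
Notation C4 R := 'rV[R[i]]_(1 + 3).

Section C4.
Variable R : realType.
Implicit Types (z : C4 R) (w : R[i]) (U : set R[i]) (F G : R[i] -> C4 R).

Definition c4_scal z : R[i] := lsubmx z 0 0.
Definition c4_vec z : 'rV[R[i]]_3 := rsubmx z.

(* The complex bilinear square, not the Hermitian one. *)
Definition c4_vec_sq z : R[i] := \sum_(j < 3) c4_vec z 0 j ^+ 2.

Definition sigma (k : nat) z : C4 R :=
  row_mx (eval2 (pow_re k) (c4_scal z) (c4_vec_sq z))%:M
         (eval2 (pow_im k) (c4_scal z) (c4_vec_sq z) *: c4_vec z).

Definition Omega : set (C4 R) :=
  [set z | [/\ c4_vec_sq z != 0, c4_scal z ^+ 2 + c4_vec_sq z != 0 &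
               c4_scal z != 0]].

Definition T_op G : R[i] -> C4 R := fun w => map_mx Num.conj (G w^*).

(* Functions on U are represented by total functions of which only the
   restriction to U matters. *)
Definition is_stem U F : Prop := forall w, U w -> T_op F w = F w.

End C4.

(* Main.v *)
Require Import Defs.
From mathcomp Require Import all_boot all_order all_algebra.
From mathcomp Require Import all_classical all_reals all_analysis.
From mathcomp Require Import complex ring lra separable cyclotomic.
Import Order.TTheory GRing.Theory Num.Theory numFieldNormedType.Exports.
Local Open Scope classical_set_scope.
Local Open Scope ring_scope.

(** Write [F = (f0, v)] and [s] for the bilinear square of [v], which vanishes
    nowhere. On a simply connected domain [s] has a continuous square root [r],
    and [r] can be chosen to commute with conjugation, because [s] is positive
    at the real points of the domain ([symmetric_sqrt]). The subalgebra generated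
    by [v z] is then a copy of [C * C] in which [F z] has the coordinates
    [a = f0 + 'i r] and [f0 - 'i r], and the power map acts on each coordinate
    ([sigma_root]). Their product [f0 ^+ 2 + s] vanishes nowhere, and since [f0]
    and [r] commute with conjugation, [T] exchanges them. So if [alpha] is a
    continuous [k]-th root of [a], the pair [(alpha, T alpha)] is a [k]-th root
    of [F] that [T] leaves fixed. The [k] products of [alpha] with the roots of
    unity give [k] such functions.

    What remains is that a continuous function [f] without zeros has continuous
    [k]-th roots on a simply connected domain ([root_on_simply_connected]). This
    is the lifting argument for the covering [w ^+ k = f z]. Roots along a path
    and along a homotopy come from a telescoping product of principal roots
    ([contraction_root]); two roots on a connected set that agree at a point
    agree everywhere ([roots_agree]); hence the end value of the root along a
    path depends only on the end of the path ([reaches_unique]). *)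

Set Implicit Arguments.
Unset Strict Implicit.
Unset Printing Implicit Defensive.

Local Notation Re := (@complex.Re _).
Local Notation Im := (@complex.Im _).

(** * Continuity at a point *)

Lemma near_dist_lt (K : numFieldType) (V : normedModType K) (x : V) (e : K) :
  0 < e -> \forall y \near x, `|x - y| < e.
Proof. by move=> e0; apply/nbhs_normP; exists e. Qed.

Lemma continuous_at_id (T : topologicalType) (x : T) :
  continuous_at x (fun z : T => z).
Proof. exact: cvg_id. Qed.

Lemma continuous_at_cst (T U : topologicalType) (x : T) (c : U) :
  continuous_at x (fun _ : T => c).
Proof. exact: cst_continuous. Qed.

Lemma continuous_at_comp (T U V : topologicalType) (f : T -> U) (g : U -> V)
    (x : T) :
  continuous_at x f -> continuous_at (f x) g ->
  continuous_at x (fun t => g (f t)).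
Proof. exact: continuous_comp. Qed.

Lemma continuous_at_near_eq (T U : topologicalType) (x : T) (f g : T -> U) :
  (\forall y \near x, f y = g y) -> continuous_at x f -> continuous_at x g.
Proof.
move=> fg fx; rewrite /continuous_at -(nbhs_singleton fg).
by apply: cvg_trans fx; exact: (@near_eq_cvg _ _ (nbhs x)).
Qed.

Lemma continuous_at_pair (T U V : topologicalType) (x : T) (f : T -> U)
    (g : T -> V) :
  continuous_at x f -> continuous_at x g ->
  continuous_at x (fun t => (f t, g t)).
Proof. by move=> fx gx; exact: cvg_pair. Qed.

Lemma continuous_at_fst (T U : topologicalType) (p : T * U) : continuous_at p fst.
Proof. exact: cvg_fst. Qed.

Lemma continuous_at_snd (T U : topologicalType) (p : T * U) : continuous_at p snd.
Proof. exact: cvg_snd. Qed.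

(** How a map known to be continuous only relative to a set, such as a
    path or a homotopy on the unit square, becomes continuous everywhere:
    precompose it with a continuous retraction onto that set. *)
Lemma continuous_at_within_comp (T U V : topologicalType) (A : set U)
    (f : U -> V) (c : T -> U) (x : T) :
  {within A, continuous f} -> continuous_at x c -> (forall y, A (c y)) ->
  continuous_at x (fun y => f (c y)).
Proof.
move=> /subspace_continuousP fA cx Ac W /(fA _ (Ac x)) /cx.
by apply: (@filterS _ (nbhs x)) => y /(_ (Ac y)).
Qed.

Lemma continuous_at_mx (T U : topologicalType) m n (x : T)
    (G : T -> 'M[U]_(m, n)) :
  (forall i j, continuous_at x (fun y => G y i j)) -> continuous_at x G.
Proof.
move=> Gx W [P PG PW].
have h i j : \forall y \near x, P i j (G y i j) by apply: Gx; exact: PG.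
have h' : \forall y \near x, forall i j, P i j (G y i j).
  by apply: filter_forall => i; apply: filter_forall => j; exact: h.
by apply: (@filterS _ (nbhs x)) h' => y; exact: PW.
Qed.

Section Arithmetic.
Variables (K : numFieldType) (T : topologicalType) (x : T).
Implicit Types f g : T -> K.

Lemma continuous_atD f g : continuous_at x f -> continuous_at x g ->
  continuous_at x (fun t => f t + g t).
Proof. exact: continuousD. Qed.

Lemma continuous_atB f g : continuous_at x f -> continuous_at x g ->
  continuous_at x (fun t => f t - g t).
Proof. exact: continuousB. Qed.

Lemma continuous_atM f g : continuous_at x f -> continuous_at x g ->
  continuous_at x (fun t => f t * g t).
Proof. exact: continuousM. Qed.

Lemma continuous_atV f : f x != 0 -> continuous_at x f ->
  continuous_at x (fun t => (f t)^-1).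
Proof. exact: continuousV. Qed.

Lemma continuous_atX n f : continuous_at x f ->
  continuous_at x (fun t => f t ^+ n).
Proof.
move=> fx; elim: n => [|n IH]; first exact: continuous_at_cst.
under eq_fun do rewrite exprS.
exact: continuous_atM.
Qed.

End Arithmetic.

(** * The complex plane and the principal root *)

Section ComplexTopology.
Variable R : realType.
Local Notation C := R[i].

Lemma continuous_Re : continuous (Re : C -> R).
Proof.
move=> x; apply/(@cvgrPdist_lt _ _ _ (nbhs x)) => e e0.
have e0' : 0 < e%:C%C :> C by rewrite ltcR.
near=> y.
have : `|x - y| < e%:C%C by near: y; exact: near_dist_lt.
by move=> /(le_lt_trans (normc_ge_Re _)); rewrite ltcR raddfB.
Unshelve. all: by end_near. Qed.

Lemma continuous_real_complex : continuous (real_complex R : R -> C).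
Proof.
move=> x; apply/(@cvgrPdist_lt _ _ _ (nbhs x)) => e e0.
have [e1 eE] : 0 < Re e /\ (Re e)%:C%C = e.
  by case: e e0 => a b; rewrite ltcE /= => /andP[/eqP -> ->].
near=> y.
rewrite -rmorphB /= normc_def /= expr0n addr0 sqrtr_sqr -eE ltcR.
by near: y; exact: (@near_dist_lt R R^o).
Unshelve. all: by end_near. Qed.

Lemma continuous_conj : continuous (Num.conj : C -> C).
Proof.
move=> x; apply/(@cvgrPdist_lt _ _ _ (nbhs x)) => e e0; near=> y.
rewrite -rmorphB norm_conjC.
by near: y; exact: near_dist_lt.
Unshelve. all: by end_near. Qed.

Lemma continuous_Im : continuous (Im : C -> R).
Proof.
move=> x; apply/(@cvgrPdist_lt _ _ _ (nbhs x)) => e e0.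
have e0' : 0 < e%:C%C :> C by rewrite ltcR.
near=> y.
have : `|x - y| < e%:C%C by near: y; exact: near_dist_lt.
have i1 : `|'i%C : C| = 1 by rewrite normc_def /= expr0n expr1n add0r sqrtr1.
rewrite -[`|x - y|]mulr1 -i1 -normrM => /(le_lt_trans (normc_ge_Re _)).
by rewrite ReiNIm normrN ltcR raddfB.
Unshelve. all: by end_near. Qed.

Lemma continuous_at_Complex (T : topologicalType) (x : T) (a b : T -> R) :
  continuous_at x a -> continuous_at x b ->
  continuous_at x (fun t => Complex (a t) (b t) : C).
Proof.
move=> ax bx.
have -> : (fun t => Complex (a t) (b t) : C) =
    (fun t => (a t)%:C%C + 'i%C * (b t)%:C%C).
  by apply/funext => t; exact: (complexE (Complex (a t) (b t))).
apply: continuous_atD.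
  exact: (continuous_at_comp ax (@continuous_real_complex _)).
apply: continuous_atM; first exact: continuous_at_cst.
exact: (continuous_at_comp bx (@continuous_real_complex _)).
Qed.

(** The complex exponential of [a + ib]. *)
Definition cexp (a b : R) : C := Complex (expR a * cos b) (expR a * sin b).

Lemma cexpX a b n : cexp a b ^+ n = cexp (n%:R * a) (n%:R * b).
Proof.
elim: n => [|n IH].
  by rewrite expr0 !mul0r /cexp expR0 cos0 sin0 mulr1 mulr0.
rewrite exprS IH -natr1 !mulrDl !mul1r /cexp expRD cosD sinD.
by apply/eqP; rewrite eq_complex /=; apply/andP; split; apply/eqP; ring.
Qed.

Lemma cexp_polar (v : C) : 0 < Re v ->
  cexp (ln (Num.sqrt (Re v ^+ 2 + Im v ^+ 2))) (atan (Im v / Re v)) = v.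
Proof.
case: v => x y /= x0; rewrite /cexp.
set m := Num.sqrt _.
have m0 : 0 < m by rewrite sqrtr_gt0 ltr_pwDl ?sqr_ge0// exprn_gt0.
have cE : cos (atan (y / x)) = x / m.
  rewrite cos_atan.
  have -> : 1 + (y / x) ^+ 2 = (x ^+ 2 + y ^+ 2) / x ^+ 2.
    by field; rewrite gt_eqF.
  rewrite sqrtrM ?addr_ge0 ?sqr_ge0// sqrtrV ?sqr_ge0// sqrtr_sqr gtr0_norm//.
  by rewrite invf_div.
have sE : sin (atan (y / x)) = y / m.
  have := atanK (y / x); rewrite /tan cE => h.
  have -> : sin (atan (y / x)) = y / x * (x / m).
    by rewrite -[in RHS]h divfK// mulf_neq0 ?invr_eq0 ?gt_eqF.
  by field; rewrite !gt_eqF.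
rewrite lnK ?posrE// cE sE; congr Complex; field; exact: lt0r_neq0.
Qed.

(** The arctangent of [Im v / Re v] is the argument of [v] only in the right
    half-plane, which is where this is a [k]-th root. *)
Definition principal_root k (v : C) : C :=
  cexp (ln (Num.sqrt (Re v ^+ 2 + Im v ^+ 2)) / k%:R) (atan (Im v / Re v) / k%:R).

Lemma principal_rootX k v : (0 < k)%N -> 0 < Re v ->
  principal_root k v ^+ k = v.
Proof.
move=> k0 v0; rewrite cexpX -[RHS]cexp_polar//.
by congr cexp; rewrite mulrC divfK// pnatr_eq0 -lt0n.
Qed.

Lemma principal_root1 k : principal_root k 1 = 1.
Proof.
by rewrite /principal_root /= expr1n expr0n addr0 sqrtr1 ln1 mul0r mul0r atan0
  mul0r /cexp expR0 cos0 sin0 mulr1 mulr0.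
Qed.

Lemma continuous_principal_root k v : 0 < Re v ->
  continuous_at v (principal_root k).
Proof.
move=> v0.
have cR := @continuous_Re v; have cI := @continuous_Im v.
have c1 : continuous_at v
    (fun v : C => ln (Num.sqrt (Re v ^+ 2 + Im v ^+ 2)) / k%:R).
  apply: continuous_atM; last exact: continuous_at_cst.
  apply: (@continuous_at_comp _ _ _ _ (@ln R)).
    apply: (@continuous_at_comp _ _ _ _ (@Num.sqrt R)).
      by apply: continuous_atD; apply: continuous_atX.
    exact: sqrt_continuous.
  by apply: continuous_ln; rewrite sqrtr_gt0 ltr_pwDl ?sqr_ge0// exprn_gt0.
have c2 : continuous_at v (fun v : C => atan (Im v / Re v) / k%:R).
  apply: continuous_atM; last exact: continuous_at_cst.
  apply: (@continuous_at_comp _ _ _ _ (@atan R)); last exact: continuous_atan.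
  by apply: continuous_atM => //; apply: continuous_atV => //; rewrite gt_eqF.
apply: continuous_at_Complex; apply: continuous_atM.
- exact: (continuous_at_comp c1 (@continuous_expR R _)).
- exact: (continuous_at_comp c2 (@continuous_cos R _)).
- exact: (continuous_at_comp c1 (@continuous_expR R _)).
- exact: (continuous_at_comp c2 (@continuous_sin R _)).
Qed.

Lemma near1_Re_gt0 (v : C) : `|1 - v| < 1 -> 0 < Re v.
Proof.
move=> /(le_lt_trans (normc_ge_Re _)); rewrite ltcR raddfB /= ltr_norml; lra.
Qed.

End ComplexTopology.

(** * Roots of nonvanishing functions on the square *)

Section Clamp.
Variable R : realType.

Definition clamp (t : R) : R := Num.max 0 (Num.min t 1).

Lemma clampP t : 0 <= clamp t <= 1.
Proof. by rewrite /clamp le_max lexx ge_max ler01 ge_min lexx orbT. Qed.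

Lemma clamp_id t : 0 <= t <= 1 -> clamp t = t.
Proof. by rewrite /clamp => /andP[t0 t1]; rewrite min_l// max_r. Qed.

Lemma clamp_le0 t : t <= 0 -> clamp t = 0.
Proof. by move=> t0; rewrite /clamp max_l// ge_min t0. Qed.

Lemma clamp_ge1 t : 1 <= t -> clamp t = 1.
Proof. by move=> t1; rewrite /clamp min_r// max_r. Qed.

Lemma continuous_clamp : continuous clamp.
Proof.
move=> t; apply: (@continuous_max R R (fun=> 0) (fun t => Num.min t 1)).
  exact: continuous_at_cst.
apply: (@continuous_min R R id (fun=> 1)); first exact: continuous_at_id.
exact: continuous_at_cst.
Qed.

End Clamp.

Section Roots.
Variable R : realType.
Local Notation C := R[i].
Variable k : nat.
Hypothesis k_gt0 : (0 < k)%N.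

(** The quotient of two roots is continuous with values in the finite, hence
    discrete, set of [k]-th roots of unity, so it is constant on a connected
    set. *)
Lemma roots_agree (T : topologicalType) (A : set T) (f g : T -> C) (x : T) :
  connected A ->
  (forall y, A y -> continuous_at y f) -> (forall y, A y -> continuous_at y g) ->
  (forall y, A y -> f y ^+ k = g y ^+ k) -> (forall y, A y -> g y != 0) ->
  A x -> f x = g x -> forall y, A y -> f y = g y.
Proof.
move=> Ac fc gc fgk g0 Ax fgx.
pose q y := f y / g y.
have qc : {within A, continuous q}.
  apply: continuous_in_subspaceT => y /[!inE] Ay.
  by apply: continuous_atM; [exact: fc|apply: continuous_atV; [exact: g0|exact: gc]].
have qk y : A y -> q y ^+ k = 1.
  by move=> Ay; rewrite expr_div_n fgk// divff// expf_neq0// g0.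
pose rts : set C := [set w | w ^+ k = 1 /\ w != 1].
have acc : accessible_space C.
  by apply: hausdorff_accessible; exact: (@norm_hausdorff C C).
have rts_fin : finite_set rts.
  have p0 : 'X^k - 1 != 0 :> {poly C} by rewrite monic_neq0// monicXnsubC.
  have [s sE] := closed_field_poly_normal ('X^k - 1 : {poly C}).
  apply: (@sub_finite_set _ _ [set` s]); last exact: finite_seq.
  move=> w /= [wk _].
  have : root ('X^k - 1) w by rewrite /root !hornerE wk subrr.
  by rewrite sE rootZ ?lead_coef_eq0// root_prod_XsubC.
have := connected_continuous_connected Ac qc.
move=> /(_ [set 1]) H; have : [set 1] = q @` A; last first.
  move=> qA y Ay; have : (q @` A) (q y) by exists y.
  rewrite -qA /= /q => /(congr1 (fun z => z * g y)).
  by rewrite divfK ?g0// mul1r.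
have q1 : (q @` A) 1 by exists x => //; rewrite /q fgx divff// g0.
apply: H.
- by exists 1.
- exists (~` rts).
    by apply: closed_openC; apply: (iffLR (accessible_finite_set_closed) acc).
  apply/seteqP; split=> [_ ->|w [[y Ay <-] /= h]].
    by split => //= -[_]; rewrite eqxx.
  by apply: contrapT => /eqP ne1; apply: h; split => //; exact: qk.
- exists [set 1]; first exact: (@accessible_closed_set1 _ acc).
  by apply/seteqP; split=> [_ ->|w [] //]; split.
Qed.

(** A function that can be deformed to a constant has a root. By compactness
    there is one step [1/N] for which the quotient of the function at times
    [t + 1/N] and [t] stays within distance 1 of 1, uniformly in the point and
    in [t]; the principal root applies to each quotient, and the product of the
    [N] roots telescopes. *)
Lemma contraction_root (T : topologicalType) (K : set T) (E : R * T -> C) (c : C) :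
  compact K -> continuous E -> (forall p, E p != 0) ->
  (forall x, E (0, x) = c) ->
  exists rho : T -> C, forall x, K x ->
    continuous_at x rho /\ rho x ^+ k = E (1, x).
Proof.
move=> Kc Ec E0 Ec0.
have [n nP] : exists n, forall p : R * T, 0 <= p.1 <= 1 -> K p.2 ->
    `|1 - E (p.1 + n.+1%:R^-1, p.2) / E p| < 1.
  have Kc' : compact (`[(0 : R), 1]%classic `*` K).
    by apply: compact_setX => //; exact: segment_compact.
  pose P (d : R) (p : R * T) := `|1 - E (p.1 + d, p.2) / E p| < 1.
  (* [P d p] is an open condition on [(p, d)] that holds for [d = 0], so it
     holds on all of the compact set as soon as [d] is small. *)
  have := (compact_near_coveringP _).1 Kc' R (nbhs 0) P.
  have near0 (p : R * T) : \forall p' \near p & d \near (0 : R), P d p'.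
    pose Q (u : (R * T) * R) : C := E (u.1.1 + u.2, u.1.2) / E u.1.
    have Qc : continuous_at (p, 0) Q.
      have c1 : continuous_at (p, 0 : R) fst by exact: continuous_at_fst.
      have c2 : continuous_at (p, 0 : R) snd by exact: continuous_at_snd.
      apply: continuous_atM; last first.
        apply: continuous_atV => //.
        by apply: (continuous_at_comp c1); exact: Ec.
      apply: (@continuous_at_comp _ _ _
        (fun u : (R * T) * R => (u.1.1 + u.2, u.1.2)) E); last exact: Ec.
      apply: continuous_at_pair.
        apply: continuous_atD => //.
        exact: (continuous_at_comp c1 (@continuous_at_fst _ _ _)).
      exact: (continuous_at_comp c1 (@continuous_at_snd _ _ _)).
    have Q1 : Q (p, 0) = 1 by rewrite /Q /= addr0 -surjective_pairing divff.
    have W : nbhs (Q (p, 0)) [set w : C | `|1 - w| < 1].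
      by rewrite Q1; exact: near_dist_lt.
    exact: (Qc _ W).
  move=> /(_ _ (fun p _ => near0 p)) nP.
  have [n /= nP'] := @filter_ex _ \oo _ _ (@cvg_harmonic R _ nP).
  by exists n => p p1 p2; exact: nP'.
have key j : (j <= n.+1)%N -> exists rho : T -> C, forall x, K x ->
    continuous_at x rho /\ rho x ^+ k = E (j%:R / n.+1%:R, x).
  elim: j => [_|j IH jn].
    exists (fun=> k.-root c) => x Kx; split; first exact: continuous_at_cst.
    by rewrite mul0r Ec0 rootCK.
  have [rho rhoP] := IH (ltnW jn).
  pose v x := E (j.+1%:R / n.+1%:R, x) / E (j%:R / n.+1%:R, x).
  have EcT t x : continuous_at x (fun x => E (t, x)).
    apply: (@continuous_at_comp _ _ _ (fun x => (t, x)) E); last exact: Ec.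
    by apply: continuous_at_pair; [exact: continuous_at_cst|exact: continuous_at_id].
  exists (fun x => rho x * principal_root k (v x)) => x Kx.
  have v0 : 0 < Re (v x).
    apply: near1_Re_gt0.
    have -> : v x = E (j%:R / n.+1%:R + n.+1%:R^-1, x) / E (j%:R / n.+1%:R, x).
      by rewrite /v -natr1 mulrDl mul1r.
    apply: (nP (j%:R / n.+1%:R, x)) => //=.
    by rewrite divr_ge0//= ler_pdivrMr// mul1r ler_nat ltnW.
  have [rc rk] := rhoP x Kx; split.
    apply: (continuous_atM rc).
    apply: (@continuous_at_comp _ _ _ v (principal_root k)).
      apply: (continuous_atM (EcT _ _)).
      by apply: continuous_atV; [exact: E0|exact: EcT].
    exact: continuous_principal_root.
  by rewrite exprMn rk principal_rootX// /v mulrCA divff// mulr1.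
have [rho rhoP] := key n.+1 (leqnn _).
by exists rho => x Kx; have [] := rhoP x Kx; rewrite divff.
Qed.

Definition clamp2 (p : R * R) : R * R := (clamp p.1, clamp p.2).

Lemma continuous_clamp2 : continuous clamp2.
Proof.
move=> p; apply: continuous_at_pair.
  by apply: (continuous_at_comp (@continuous_at_fst _ _ p)); exact: continuous_clamp.
by apply: (continuous_at_comp (@continuous_at_snd _ _ p)); exact: continuous_clamp.
Qed.

(** The square is star-shaped about its corner, so [h] is deformed to the
    constant [h (0, 0)] by scaling its argument. The clamp makes the root
    continuous on the whole plane. *)
Lemma square_root (h : R * R -> C) :
  continuous h -> (forall p, h p != 0) ->
  exists rho : R * R -> C, continuous rho /\ forall p, rho p ^+ k = h (clamp2 p).
Proof.
move=> hc h0.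
pose E (u : R * (R * R)) := h (u.1 * u.2.1, u.1 * u.2.2).
have Ec : continuous E.
  move=> u; apply: (@continuous_at_comp _ _ _
    (fun u : R * (R * R) => (u.1 * u.2.1, u.1 * u.2.2)) h); last exact: hc.
  have c1 : continuous_at u fst by exact: continuous_at_fst.
  have c2 : continuous_at u snd by exact: continuous_at_snd.
  apply: continuous_at_pair; apply: continuous_atM => //.
    exact: (continuous_at_comp c2 (@continuous_at_fst _ _ _)).
  exact: (continuous_at_comp c2 (@continuous_at_snd _ _ _)).
have Kc : compact (`[(0 : R), 1]%classic `*` `[(0 : R), 1]%classic).
  by apply: compact_setX; exact: segment_compact.
have [||rho rhoP] := contraction_root (c := h (0, 0)) Kc Ec.
- by move=> u; exact: h0.
- by move=> x; rewrite /E /= !mul0r.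
have Kcl p : (`[(0 : R), 1]%classic `*` `[(0 : R), 1]%classic) (clamp2 p).
  by split; rewrite /= in_itv /= clampP.
exists (fun p => rho (clamp2 p)); split => p.
  apply: (continuous_at_comp (@continuous_clamp2 p)).
  by have [] := rhoP _ (Kcl p).
by have [_ ->] := rhoP _ (Kcl p); rewrite /E /= !mul1r.
Qed.

Lemma path_root (h : R -> C) :
  continuous h -> (forall t, h t != 0) ->
  exists rho : R -> C, continuous rho /\ forall t, rho t ^+ k = h (clamp t).
Proof.
move=> hc h0; have [||rho [rc rk]] := @square_root (fun p => h p.1).
- by move=> p; exact: (continuous_at_comp (@continuous_at_fst _ _ p) (hc _)).
- by move=> p; exact: h0.
exists (fun t => rho (t, 0)); split => t; last by rewrite rk.
apply: (@continuous_at_comp _ _ _ (fun t => (t, 0)) rho); last exact: rc.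
by apply: continuous_at_pair; [exact: continuous_at_id|exact: continuous_at_cst].
Qed.

Lemma path_roots_agree (f g : R -> C) : continuous f -> continuous g ->
  (forall t : R, 0 <= t <= 1 -> f t ^+ k = g t ^+ k) ->
  (forall t : R, 0 <= t <= 1 -> g t != 0) -> f 0 = g 0 -> f 1 = g 1.
Proof.
move=> fc gc fgk g0 fg0.
have I (t : R) : `[0, 1]%classic t = is_true (0 <= t <= 1) by rewrite /= in_itv.
apply: (@roots_agree R `[0, 1]%classic f g 0); rewrite ?I ?lexx ?ler01//.
exact: segment_connected.
Qed.

End Roots.

(** * Roots on simply connected domains *)

Section Concatenation.
Variables (R : realType).
Local Notation C := R[i].
Implicit Types g h : R -> C.

(** Concatenation of [g] and [h] when [h 0 = g 1]: on each half of the interval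
    one of the first two terms is stuck at the junction and cancels the third.
    Unlike a definition by cases, this one is continuous by construction. *)
Definition cat_path g h (t : R) : C :=
  g (clamp (2 * t)) + h (clamp (2 * t - 1)) - g 1.

Lemma cat_path_left g h t : h 0 = g 1 -> t <= 1 / 2 ->
  cat_path g h t = g (clamp (2 * t)).
Proof.
move=> h0 t1; rewrite /cat_path [clamp (2 * t - 1)]clamp_le0 ?h0 ?addrK//.
lra.
Qed.

Lemma cat_path_right g h t : 1 / 2 <= t ->
  cat_path g h t = h (clamp (2 * t - 1)).
Proof.
move=> t1; rewrite /cat_path [clamp (2 * t)]clamp_ge1; last lra.
by rewrite addrAC subrr add0r.
Qed.

Lemma continuous_cat_path g h : continuous g -> continuous h ->
  continuous (cat_path g h).
Proof.
move=> gc hc t.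
have c2 : continuous_at t (fun t : R => 2 * t).
  by apply: continuous_atM; [exact: continuous_at_cst|exact: continuous_at_id].
apply: continuous_atB; last exact: continuous_at_cst.
apply: continuous_atD.
  exact: (continuous_at_comp (continuous_at_comp c2 (@continuous_clamp R _)) (gc _)).
have c3 : continuous_at t (fun t : R => 2 * t - 1).
  by apply: (continuous_atB c2); exact: continuous_at_cst.
exact: (continuous_at_comp (continuous_at_comp c3 (@continuous_clamp R _)) (hc _)).
Qed.

Lemma cat_path_lift (P : C -> C -> Prop) g h g' h' :
  h 0 = g 1 -> h' 0 = g' 1 ->
  (forall t, P (g t) (g' t)) -> (forall t, P (h t) (h' t)) ->
  forall t, P (cat_path g h t) (cat_path g' h' t).
Proof.
move=> h0 h0' Pg Ph t; have [t1|t1] := lerP t (1 / 2).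
  by rewrite !cat_path_left.
by rewrite !cat_path_right// ltW.
Qed.

End Concatenation.

Section Lifting.
Variable R : realType.
Local Notation C := R[i].
Variables (k : nat) (U : set C) (f : C -> C) (z0 w0 : C).
Hypothesis k_gt0 : (0 < k)%N.
Hypothesis scU : simply_connected_domain U.
Hypothesis fc : forall z, U z -> continuous_at z f.
Hypothesis f0 : forall z, U z -> f z != 0.
Hypothesis Uz0 : U z0.
Hypothesis w0k : w0 ^+ k = f z0.

(** A path of [U] with a continuous choice of [k]-th roots of [f] along it: a
    path in the [k]-fold covering of [U] defined by [w ^+ k = f z]. *)
Record lift_path (g rho : R -> C) : Prop := LiftPath {
  lift_cont : continuous g;
  lift_in : forall t, U (g t);
  lift_root_cont : continuous rho;
  lift_root : forall t, rho t ^+ k = f (g t) }.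

(** The point [(z, w)] of the covering is joined to [(z0, w0)]; over a simply
    connected [U] this relation is the graph of the root sought. *)
Definition reaches (z w : C) : Prop :=
  exists g rho : R -> C,
    [/\ lift_path g rho, g 0 = z0 /\ rho 0 = w0 & g 1 = z /\ rho 1 = w].

Lemma fcomp_continuous (T : topologicalType) (c : T -> C) :
  continuous c -> (forall t, U (c t)) -> continuous (fun t => f (c t)).
Proof. by move=> cc Uc t; apply: (continuous_at_comp (cc t)); exact: fc. Qed.

Lemma reaches_exists z : U z -> exists w, reaches z w.
Proof.
move=> Uz; have [_ _ _ [pc _]] := scU.
have [g [gc gU] [g0 g1]] := pc _ _ Uz0 Uz.
pose g' t := g (clamp t).
have g'c : continuous g'.
  move=> t; apply: (continuous_at_within_comp gc); first exact: continuous_clamp.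
  by move=> y; rewrite /= in_itv /= clampP.
have g'U t : U (g' t) by apply: gU; exact: clampP.
have [t|rho [rc rk]] := path_root k_gt0 (fcomp_continuous g'c g'U).
  exact: f0.
have rk' t : rho t ^+ k = f (g' t).
  by rewrite rk /g' [clamp (clamp t)]clamp_id// clampP.
have g'0 : g' 0 = z0 by rewrite /g' clamp_le0.
have g'1 : g' 1 = z by rewrite /g' clamp_ge1.
have r0 : rho 0 ^+ k != 0 by rewrite rk'; exact: f0.
exists (rho 1 * (w0 / rho 0)), g', (fun t => rho t * (w0 / rho 0)).
have r0' : rho 0 != 0 by apply: contraNneq r0 => ->; rewrite expr0n gtn_eqF.
split; last 2 first.
- by split; rewrite // mulrCA divff ?mulr1.
- by split.
split; [exact: g'c|exact: g'U| |] => t.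
  by apply: (continuous_atM (rc t)); exact: continuous_at_cst.
by rewrite !exprMn exprVn rk' rk' g'0 w0k divff ?mulr1// f0.
Qed.

Lemma reaches_extend z w g rho :
  reaches z w -> lift_path g rho -> g 0 = z -> rho 0 = w -> reaches (g 1) (rho 1).
Proof.
move=> [h [sig [hs [h0 s0] [h1 s1]]]] gr g0 r0.
have gh : g 0 = h 1 by rewrite g0 h1.
have rs : rho 0 = sig 1 by rewrite r0 s1.
have e t : U (cat_path h g t) /\ cat_path sig rho t ^+ k = f (cat_path h g t).
  apply: (cat_path_lift (P := fun x y => U x /\ y ^+ k = f x) gh rs) => u.
    by split; [exact: (lift_in hs)|exact: (lift_root hs)].
  by split; [exact: (lift_in gr)|exact: (lift_root gr)].
exists (cat_path h g), (cat_path sig rho); split.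
- split; try by [move=> t; case: (e t)].
    by apply: continuous_cat_path; [exact: (lift_cont hs)|exact: (lift_cont gr)].
  apply: continuous_cat_path; first exact: (lift_root_cont hs).
  exact: (lift_root_cont gr).
- by rewrite !cat_path_left ?mulr0 ?clamp_le0//; lra.
- have h2 : 1 / 2 <= 1 :> R by lra.
  by rewrite !(cat_path_right _ _ h2) clamp_ge1//; lra.
Qed.

(** Two paths to [z] form a loop, which a homotopy [H] contracts. A root [S] of
    [f] along the whole homotopy is constant on the three edges of the square
    that [H] sends to [z0], hence the root along the loop, found on the fourth
    edge, comes back to its initial value. Going along the loop from either end
    to its middle, it follows the two given roots, which therefore agree. *)
Lemma reaches_unique z w1 w2 : reaches z w1 -> reaches z w2 -> w1 = w2.
Proof.
move=> [g1 [r1 [l1 [g10 r10] [g11 r11]]]] [g2 [r2 [l2 [g20 r20] [g21 r21]]]].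
have rev (h : R -> C) : continuous h -> continuous (fun t : R => h (1 - t)).
  move=> hc t.
  apply: (@continuous_at_comp _ _ _ (fun t : R => 1 - t) h); last exact: hc.
  by apply: continuous_atB; [exact: continuous_at_cst|exact: continuous_at_id].
pose l := cat_path g1 (fun t : R => g2 (1 - t)).
have glue : g2 (1 - 0) = g1 1 by rewrite subr0 g21 g11.
have lleft (t : R) : 0 <= t <= 1 -> l (t / 2) = g1 t.
  move=> t01; rewrite /l cat_path_left//; last by move: t01; lra.
  by rewrite mulrCA divff ?mulr1 ?clamp_id.
have lright (t : R) : 0 <= t <= 1 -> l (1 - t / 2) = g2 t.
  move=> t01; rewrite /l cat_path_right; last by move: t01; lra.
  have -> : 2 * (1 - t / 2) - 1 = 1 - t by field.
  by rewrite clamp_id ?subKr//; move: t01; lra.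
have l0 : l 0 = z0 by rewrite -(mul0r 2^-1) lleft ?lexx ?ler01.
have l1' : l 1 = z0.
  by have := lright 0; rewrite mul0r subr0 => ->; rewrite ?lexx ?ler01.
have lc : continuous l.
  apply: continuous_cat_path; first exact: (lift_cont l1).
  exact: rev (lift_cont l2).
have lU t : U (l t).
  apply: (@cat_path_lift _ (fun x _ => U x) g1 (fun t : R => g2 (1 - t))
            g1 (fun t : R => g2 (1 - t)) glue glue) => u.
    exact: (lift_in l1).
  exact: (lift_in l2).
have [_ _ _ [_ nullh]] := scU.
have [||H [Hc HU Hs Ht]] := nullh l.
- by split => [|t _]; [exact: continuous_subspaceT|exact: lU].
- by rewrite l0 l1'.
pose H' p := H (clamp2 p).
have H'c : continuous H'.
  move=> p; apply: (continuous_at_within_comp Hc); first exact: continuous_clamp2.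
  by move=> y; split; rewrite /= in_itv /= clampP.
have H'U p : U (H' p) by apply: HU; exact: clampP.
have [p|S [Sc Sk]] := square_root k_gt0 (fcomp_continuous H'c H'U).
  exact: f0.
have {}Sk (s t : R) : 0 <= s <= 1 -> 0 <= t <= 1 -> S (s, t) ^+ k = f (H (s, t)).
  by move=> s01 t01; rewrite Sk /H' /clamp2 /= !clamp_id// clampP.
have edge (u : R -> R * R) : continuous u ->
    (forall t : R, 0 <= t <= 1 -> S (u t) ^+ k = f z0) -> S (u 0) = S (u 1).
  move=> uc uk; symmetry.
  have I0 : 0 <= (0 : R) <= 1 by rewrite lexx ler01.
  apply: (path_roots_agree k_gt0 (f := S \o u) (g := fun=> S (u 0))).
  - by move=> t; exact: (continuous_at_comp (uc t)).
  - by move=> t; exact: continuous_at_cst.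
  - by move=> t t01; rewrite /= !uk.
  - move=> _ _; have := f0 Uz0; rewrite -(uk 0 I0).
    by apply: contraNneq => ->; rewrite expr0n gtn_eqF.
  - by [].
have I0 : 0 <= (0 : R) <= 1 by rewrite lexx ler01.
have I1 : 0 <= (1 : R) <= 1 by rewrite lexx ler01.
have c_id (T : topologicalType) (x : T) := @continuous_at_id T x.
have c_cst (T V : topologicalType) (x : T) (v : V) := @continuous_at_cst T V x v.
have S10 : S (0, 0) = S (1, 0).
  apply: (edge (fun t => (t, 0))) => [t|t t01].
    exact: continuous_at_pair.
  by rewrite Sk// (Ht t t01).1 l0.
have S11 : S (1, 0) = S (1, 1).
  apply: (edge (fun t => (1, t))) => [t|t t01].
    exact: continuous_at_pair.
  by rewrite Sk// (Hs t t01).2 l0.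
have S01 : S (0, 1) = S (1, 1).
  apply: (edge (fun t => (t, 1))) => [t|t t01].
    exact: continuous_at_pair.
  by rewrite Sk// (Ht t t01).2 l0.
have S00k : S (0, 0) ^+ k = f z0 by rewrite Sk// (Hs 0 I0).1 l0.
have S00 : S (0, 0) != 0.
  have := f0 Uz0; rewrite -S00k.
  by apply: contraNneq => ->; rewrite expr0n gtn_eqF.
(* [S] need not start at [w0]; multiplying by a root of unity corrects this. *)
pose L (t : R) := S (0, t) * (w0 / S (0, 0)).
have L0 : L 0 = w0 by rewrite /L mulrCA divff ?mulr1.
have L1 : L 1 = w0 by rewrite /L S01 -S11 -S10 mulrCA divff ?mulr1.
have Lk (t : R) : 0 <= t <= 1 -> L t ^+ k = f (l t).
  move=> t01; rewrite /L !exprMn exprVn Sk// (Hs t t01).1 w0k S00k.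
  by rewrite divff ?mulr1// f0.
have Lc : continuous L.
  move=> t; apply: continuous_atM; last exact: c_cst.
  apply: (@continuous_at_comp _ _ _ (fun t : R => (0, t)) S); last exact: Sc.
  exact: continuous_at_pair.
have half (t : R) : continuous_at t (fun t : R => t / 2).
  exact: (continuous_atM (@c_id _ _) (@c_cst _ _ _ _)).
have nz (g r : R -> C) : lift_path g r -> forall t, r t != 0.
  move=> gr t; have := f0 (lift_in gr t); rewrite -(lift_root gr).
  by apply: contraNneq => ->; rewrite expr0n gtn_eqF.
have e1 : L (1 / 2) = r1 1.
  apply: (path_roots_agree k_gt0 (f := fun t : R => L (t / 2)) (g := r1)).
  - by move=> t; exact: (continuous_at_comp (half t) (Lc _)).
  - exact: (lift_root_cont l1).
  - move=> t t01; rewrite Lk ?lleft ?(lift_root l1)//; move: t01; lra.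
  - by move=> t _; exact: (nz _ _ l1).
  - by rewrite mul0r L0 r10.
have e2 : L (1 - 1 / 2) = r2 1.
  apply: (path_roots_agree k_gt0 (f := fun t : R => L (1 - t / 2)) (g := r2)).
  - move=> t; apply: (@continuous_at_comp _ _ _ (fun t : R => 1 - t / 2) L).
      exact: (continuous_atB (@c_cst _ _ _ _) (half t)).
    exact: Lc.
  - exact: (lift_root_cont l2).
  - move=> t t01; rewrite Lk ?lright ?(lift_root l2)//; move: t01; lra.
  - by move=> t _; exact: (nz _ _ l2).
  - by rewrite mul0r subr0 L1 r20.
rewrite -r11 -r21 -e1 -e2; congr L; lra.
Qed.

(** Near a point [z], the values at [y] are reached by following the segment
    from [z] to [y], along which the principal root of [f y / f z] gives an
    explicit root: this is why the function is continuous. *)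
Lemma root_through_base_point :
  exists rho : C -> C, forall z, U z -> continuous_at z rho /\ rho z ^+ k = f z.
Proof.
have [rho rhoP] : exists rho : C -> C, forall z, U z -> reaches z (rho z).
  have : forall z, exists w, U z -> reaches z w.
    move=> z; have [Uz|nUz] := pselect (U z).
      by have [w] := reaches_exists Uz; exists w.
    by exists 0 => /nUz.
  by move=> /choice[rho rhoP]; exists rho.
have rhok z : U z -> rho z ^+ k = f z.
  by move=> /rhoP [g [r [l _ [<- <-]]]]; exact: (lift_root l).
exists rho => z Uz; split; last exact: rhok.
have Uo : open U by case: scU.
pose q y := f y / f z.
have qc y : U y -> continuous_at y q.
  by move=> Uy; exact: (continuous_atM (fc Uy) (@continuous_at_cst _ _ _ _)).
have qz : q z = 1 by rewrite /q divff// f0.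
have W : nbhs z [set y | U y /\ `|1 - q y| < 1].
  apply: filterI; first by move: Uo; rewrite openE; exact.
  have : nbhs (q z) [set w : C | `|1 - w| < 1].
    by rewrite qz; exact: near_dist_lt.
  exact: (qc z Uz).
have [e e0 eW] : exists2 e : C, 0 < e &
    forall y : C, `|z - y| < e -> U y /\ `|1 - q y| < 1.
  by have /nbhs_normP[e /= e0 eW] := W; exists e.
pose loc y := rho z * principal_root k (q y).
have locE y : `|z - y| < e -> rho y = loc y.
  move=> zy.
  pose g (t : R) : C := z + (clamp t)%:C%C * (y - z).
  have ge t : `|z - g t| < e.
    rewrite /g opprD addNKr normrN normrM; apply: le_lt_trans zy.
    rewrite (distrC z) -[leRHS]mul1r ler_wpM2r//.
    have /andP[c0 c1] := clampP t.
    by rewrite ger0_norm ?ler0c// -[1](rmorph1 (real_complex R)) lecR.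
  have gc : continuous g.
    move=> t; apply: continuous_atD; first exact: continuous_at_cst.
    apply: continuous_atM; last exact: continuous_at_cst.
    exact: (continuous_at_comp (@continuous_clamp R t) (@continuous_real_complex R _)).
  have gl : lift_path g (fun t => loc (g t)).
    split=> [||t|t]; first exact: gc.
    - by move=> t; have [] := eW _ (ge t).
    - have [Ug qg] := eW _ (ge t).
      apply: continuous_atM; first exact: continuous_at_cst.
      apply: (@continuous_at_comp _ _ _ (fun t => q (g t)) (principal_root k)).
        exact: (continuous_at_comp (gc t) (qc _ Ug)).
      exact/continuous_principal_root/near1_Re_gt0.
    - have [Ug qg] := eW _ (ge t).
      rewrite /loc exprMn rhok// principal_rootX//; last exact: near1_Re_gt0.
      by rewrite /q mulrCA divff ?mulr1// f0.
  have g0 : g 0 = z by rewrite /g clamp_le0// mul0r addr0.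
  have g1 : g 1 = y by rewrite /g clamp_ge1// mul1r addrC subrK.
  have Uy : U y by have [] := eW _ zy.
  rewrite -g1; apply: (reaches_unique (z := g 1)); first by rewrite g1; exact: rhoP.
  apply: (reaches_extend (rhoP z Uz) gl g0).
  by rewrite g0 /loc qz principal_root1 mulr1.
have loc_c : continuous_at z loc.
  apply: continuous_atM; first exact: continuous_at_cst.
  apply: (@continuous_at_comp _ _ _ q (principal_root k)); first exact: qc.
  by apply: continuous_principal_root; rewrite qz /= ltr01.
have en : \forall y \near z, loc y = rho y.
  have := near_dist_lt z e0.
  by apply: (@filterS _ (nbhs z)) => y /locE.
exact: continuous_at_near_eq en loc_c.
Qed.

End Lifting.

Lemma root_on_simply_connected (R : realType) (k : nat) (U : set R[i])
    (f : R[i] -> R[i]) : (0 < k)%N -> simply_connected_domain U ->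
  (forall z, U z -> continuous_at z f) -> (forall z, U z -> f z != 0) ->
  exists rho : R[i] -> R[i],
    forall z, U z -> continuous_at z rho /\ rho z ^+ k = f z.
Proof.
move=> k0 scU fc f0; have [[z0 Uz0] _ _ _] := scU.
exact: (root_through_base_point k0 scU fc f0 Uz0 (rootCK k0 _)).
Qed.

(** * Domains symmetric under conjugation *)

Section Admissible.
Variable R : realType.
Local Notation C := R[i].
Implicit Types (U A B : set C) (f g : C -> C).

Lemma open_near_in (A : set C) z : open A -> A z -> \forall y \near z, A y.
Proof. by rewrite openE => Ao; exact: Ao. Qed.

Lemma continuous_at_glue A B f g z : open A -> open B -> A `&` B = set0 ->
  (A z -> continuous_at z f) -> (B z -> continuous_at z g) -> (A `|` B) z ->
  continuous_at z (fun y => if pselect (A y) then f y else g y).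
Proof.
move=> Ao Bo AB fz gz [Az|Bz].
  apply: continuous_at_near_eq (fz Az).
  apply: (@filterS _ (nbhs z)) (open_near_in Ao Az) => y Ay.
  by case: pselect.
apply: continuous_at_near_eq (gz Bz).
apply: (@filterS _ (nbhs z)) (open_near_in Bo Bz) => y By.
by case: pselect => // Ay; have : (A `&` B) y by []; rewrite AB.
Qed.

Lemma conj_set_mem A z : A z -> conj_set A z^*.
Proof. by exists z. Qed.

Lemma admissible_conj U z : admissible_domain U -> U z -> U z^*.
Proof.
case=> [[_ UE] Uz|[A [B [_ _ _ AB ->]]]]; first by rewrite -UE; exact: conj_set_mem.
case=> [Az|]; first by right; rewrite -AB; exact: conj_set_mem.
by rewrite -AB => -[y Ay <-]; left; rewrite conjCK.
Qed.

Lemma admissible_open U : admissible_domain U -> open U.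
Proof.
case=> [[[]//]|[A [B [[_ Ao _ _] [_ Bo _ _] _ _ ->]]]].
exact: openU.
Qed.

Lemma admissible_nonempty U : admissible_domain U -> U !=set0.
Proof.
case=> [[[]//]|[A [B [[[z Az] _ _ _] _ _ _ ->]]]].
by exists z; left.
Qed.

Lemma root_on_admissible (k : nat) U f : (0 < k)%N -> admissible_domain U ->
  (forall z, U z -> continuous_at z f) -> (forall z, U z -> f z != 0) ->
  exists rho : C -> C, forall z, U z -> continuous_at z rho /\ rho z ^+ k = f z.
Proof.
move=> k0 [[scU _]|[A [B [scA scB AB _ ->]]]] fc f0.
  exact: root_on_simply_connected.
have [|| rA rAP] := root_on_simply_connected k0 scA (f := f).
- by move=> z Az; apply: fc; left.
- by move=> z Az; apply: f0; left.
have [|| rB rBP] := root_on_simply_connected k0 scB (f := f).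
- by move=> z Bz; apply: fc; right.
- by move=> z Bz; apply: f0; right.
exists (fun y => if pselect (A y) then rA y else rB y) => z Uz; split.
  have [_ Ao _ _] := scA; have [_ Bo _ _] := scB.
  apply: (continuous_at_glue Ao Bo AB _ _ Uz).
  - by case/rAP.
  - by case/rBP.
case: pselect => [/rAP[]//|nAz]; by case: Uz => // /rBP[].
Qed.

(** Otherwise the part of [U] in the upper half-plane would be open and closed
    in [U], nonempty, and different from [U]. *)
Lemma connected_conj_real U : U !=set0 -> connected U -> conj_set U = U ->
  exists2 x, U x & x^* = x.
Proof.
move=> [z Uz] cU UE; apply: contrapT => noreal.
have conjU w : U w -> U w^* by rewrite -{2}UE; exact: conj_set_mem.
have ImJ (w : C) : Im w^* = - Im w by case: w.
have Im0 w : U w -> Im w != 0.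
  move=> Uw; apply/eqP => w0; apply: noreal; exists w => //.
  by move: w0; case: w {Uw} => a b /= ->; congr Complex; rewrite oppr0.
pose P := U `&` [set w | 0 < Im w].
have PU : P = U.
  apply: cU.
  - have := Im0 z Uz; rewrite neq_lt => /orP[z0|z0]; last by exists z.
    by exists z^*; split; [exact: conjU|rewrite /= ImJ oppr_gt0].
  - exists [set w | 0 < Im w] => //.
    apply: (@open_comp _ _ Im [set x | 0 < x]); last exact: open_gt.
    by move=> w _; exact: continuous_Im.
  - exists [set w | 0 <= Im w].
      apply: (@closed_comp _ _ Im [set x | 0 <= x]); last exact: closed_ge.
      by move=> w _; exact: continuous_Im.
    apply/seteqP; split=> w [Uw w0]; split => //=; first exact: ltW.
    by rewrite lt_neqAle eq_sym Im0.
have [_ /= p1] : P z by rewrite PU.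
have [_ /= p2] : P z^* by rewrite PU; exact: conjU.
by move: p2; rewrite ImJ oppr_gt0 ltNge ltW.
Qed.

(** If [r] is a square root of [s], so is its conjugate [z |-> (r z^* )^*]. On
    a connected [U] the two differ by a sign, which is read off at a real point
    [x] of [U]: there [s x >= 0], so [r x] is real and the sign is [+]. When [U]
    is made of two exchanged components, a root chosen on one is transported to
    the other by conjugation. *)
Lemma symmetric_sqrt U (s : C -> C) : admissible_domain U ->
  (forall z, U z -> continuous_at z s) -> (forall z, U z -> s z != 0) ->
  (forall z, U z -> s z^* = (s z)^*) ->
  (forall z, U z -> z^* = z -> 0 <= s z) ->
  exists r : C -> C, forall z, U z ->
    [/\ continuous_at z r, r z ^+ 2 = s z & r z^* = (r z)^*].
Proof.
have conj_c (g : C -> C) z : continuous_at z^* g -> continuous_at z (fun y => (g y^*)^*).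
  move=> gz.
  exact: (continuous_at_comp (continuous_at_comp (@continuous_conj R z) gz)
           (@continuous_conj R _)).
move=> aU sc s0 sJ sR; have conjU z := @admissible_conj U z aU.
case: aU => [[scU UE]|[A [B [scA scB AB AJ UE]]]].
  have [r rP] := root_on_simply_connected (isT : (0 < 2)%N) scU sc s0.
  have [U0 _ Uc _] := scU.
  have [x Ux xR] := connected_conj_real U0 Uc UE.
  exists r => z Uz; have [rc rk] := rP z Uz; split => //.
  have : (r z^*)^* = r z; last by move=> <-; rewrite conjCK.
  apply: (roots_agree (isT : (0 < 2)%N) (f := fun y => (r y^*)^*) (g := r)
    Uc _ _ _ _ Ux).
  - by move=> y Uy; apply: conj_c; have [] := rP _ (conjU _ Uy).
  - by move=> y Uy; have [] := rP _ Uy.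
  - move=> y Uy; have [_ ryk] := rP _ Uy; have [_ ryJ] := rP _ (conjU _ Uy).
    by rewrite -rmorphXn /= ryJ ryk sJ// conjCK.
  - move=> y Uy; have [_ ryk] := rP _ Uy.
    by have := s0 y Uy; rewrite -ryk; apply: contraNneq => ->; rewrite expr0n.
  - rewrite xR; apply/CrealP; rewrite realEsqr.
    by have [_ ->] := rP _ Ux; exact: sR.
  - exact: Uz.
have [|| rA rAP] := root_on_simply_connected (isT : (0 < 2)%N) scA (f := s).
- by move=> z Az; apply: sc; rewrite UE; left.
- by move=> z Az; apply: s0; rewrite UE; left.
have BA z : B z -> A z^* by rewrite -AJ => -[y Ay <-]; rewrite conjCK.
have AB' z : A z -> B z^* by rewrite -AJ; exact: conj_set_mem.
have AnB z : A z -> ~ B z by move=> Az Bz; have : (A `&` B) z by []; rewrite AB.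
exists (fun y => if pselect (A y) then rA y else (rA y^*)^*) => z Uz; split.
- have [_ Ao _ _] := scA; have [_ Bo _ _] := scB.
  rewrite UE in Uz; apply: (continuous_at_glue Ao Bo AB _ _ Uz).
  + by case/rAP.
  + by move=> /BA/rAP[rc _]; exact: conj_c.
- case: pselect => [/rAP[]//|nA].
  move: Uz; rewrite {1}UE => -[//|Bz]; have Uz : U z by rewrite UE; right.
  have [_ e] := rAP _ (BA _ Bz).
  by rewrite -rmorphXn /= e sJ// conjCK.
- case: pselect => [Az'|nAz']; case: pselect => [Az|nAz].
  + by case: (AnB _ Az'); exact: AB'.
  + by rewrite /= conjCK.
  + by rewrite /= conjCK.
  + move: Uz; rewrite UE => -[//|/BA//].
Qed.

End Admissible.

(** * The power map and its roots *)

Lemma unity_roots (K : numClosedFieldType) (k : nat) : (0 < k)%N ->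
  exists zeta : 'I_k -> K, injective zeta /\ forall i, zeta i ^+ k = 1.
Proof.
move=> k0; have [s sE] := closed_field_poly_normal ('X^k - 1 : {poly K}).
have mon : ('X^k - 1 : {poly K}) \is monic by exact: monicXnsubC.
move: sE; rewrite (monicP mon) scale1r => sE.
have us : uniq s.
  rewrite -separable_prod_XsubC -sE; apply: separable_Xn_sub_1.
  by rewrite pnatr_eq0 -lt0n.
have ss : size s = k.
  have := size_XnsubC (1 : K) k0.
  by rewrite sE size_prod_XsubC => -[].
exists (fun i => nth 0 s i); split=> [i j /eqP|i].
  by rewrite nth_uniq ?ss// => /eqP/val_inj.
have : root ('X^k - 1) (nth 0 s i) by rewrite sE root_prod_XsubC mem_nth ?ss.
by rewrite /root !hornerE subr_eq0 => /eqP.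
Qed.

(** The identity that defines the two polynomials over the reals persists for
    complex [x] and [y], where [x] and [y] are no longer the real and imaginary
    parts. *)
Lemma pow_eval2 (K : numClosedFieldType) k (x y : K) :
  (x + 'i * y) ^+ k =
  eval2 (pow_re k) x (y ^+ 2) + 'i * y * eval2 (pow_im k) x (y ^+ 2).
Proof.
elim: k => [|k IH].
  rewrite expr0 /eval2 /pow_re /pow_im /= rmorph1 rmorph0 !hornerE.
  by [].
rewrite exprS IH pow_re_eval pow_im_eval.
have ii : 'i * 'i = -1 :> K by rewrite -expr2 sqrCi.
set P := eval2 _ _ _; set Q := eval2 _ _ _.
have -> : (x + 'i * y) * (P + 'i * y * Q) =
  x * P + ('i * 'i) * y ^+ 2 * Q + 'i * y * (P + x * Q) by ring.
by rewrite ii; ring.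
Qed.

Lemma conj_half_difference (K : numClosedFieldType) (x y w : K) :
  ((x - y) / (2 * 'i * w))^* = (y^* - x^*) / (2 * 'i * w^*).
Proof.
rewrite fmorph_div rmorphB !rmorphM /= conjC_nat conjCi.
by rewrite mulrN mulNr invrN mulrN -mulNr opprB.
Qed.

Section Stem.
Variable R : realType.
Local Notation C := R[i].

Lemma c4_eq (z : C4 R) : z = row_mx (c4_scal z)%:M (c4_vec z).
Proof. by rewrite -[LHS]hsubmxK [lsubmx z]mx11_scalar. Qed.

Lemma c4_scal_row (x : C) (v : 'rV[C]_3) : c4_scal (row_mx x%:M v) = x.
Proof. by rewrite /c4_scal row_mxKl mxE eqxx. Qed.

Lemma c4_vec_row (x : C) (v : 'rV[C]_3) : c4_vec (row_mx x%:M v) = v.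
Proof. by rewrite /c4_vec row_mxKr. Qed.

(** The subalgebra generated by a vector [v] of nonzero square [r ^+ 2] is a
    copy of [C * C], through [x + y v |-> (x + 'i y r, x - 'i y r)], and there
    the power map acts on each factor: a [k]-th root is a pair of complex
    [k]-th roots [alpha], [beta]. *)
Lemma sigma_root k (z : C4 R) (r alpha beta : C) :
  r ^+ 2 = c4_vec_sq z -> r != 0 ->
  alpha ^+ k = c4_scal z + 'i * r -> beta ^+ k = c4_scal z - 'i * r ->
  sigma k (row_mx ((alpha + beta) / 2)%:M
                  ((alpha - beta) / (2 * 'i * r) *: c4_vec z)) = z.
Proof.
move=> rk r0 ak bk; have i0 := neq0Ci C; have ii := sqrCi C.
set g := (alpha + beta) / 2; set l := (alpha - beta) / _.
have sqE : c4_vec_sq (row_mx g%:M (l *: c4_vec z)) = (l * r) ^+ 2.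
  rewrite /c4_vec_sq c4_vec_row exprMn rk /c4_vec_sq mulr_sumr.
  by apply: eq_bigr => j _; rewrite mxE exprMn.
rewrite /sigma sqE c4_scal_row c4_vec_row [RHS]c4_eq scalerA.
have aE : g + 'i * (l * r) = alpha by rewrite /g /l; field; rewrite r0 i0.
have bE : g + 'i * - (l * r) = beta by rewrite /g /l; field; rewrite r0 i0.
have := pow_eval2 k g (l * r); have := pow_eval2 k g (- (l * r)).
rewrite aE bE sqrrN ak bk.
set P := eval2 _ _ _; set Q := eval2 _ _ _ => e1 e2.
have PE : P = c4_scal z.
  apply: (mulfI (_ : 2 != 0 :> C)); first by rewrite pnatr_eq0.
  have -> : 2 * P = (P + 'i * (l * r) * Q) + (P + 'i * - (l * r) * Q) by ring.
  by rewrite -e1 -e2; ring.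
have QE : Q * l = 1.
  apply: (mulfI (_ : 2 * 'i * r != 0)); first by rewrite !mulf_neq0 ?pnatr_eq0.
  have -> : 2 * 'i * r * (Q * l) = (P + 'i * (l * r) * Q) - (P + 'i * - (l * r) * Q).
    by ring.
  by rewrite -e1 -e2; ring.
by rewrite PE QE scale1r.
Qed.

Lemma conj_c4_scal (z : C4 R) : c4_scal (map_mx Num.conj z) = (c4_scal z)^*.
Proof. by rewrite /c4_scal !mxE. Qed.

Lemma conj_c4_vec (z : C4 R) : c4_vec (map_mx Num.conj z) = map_mx Num.conj (c4_vec z).
Proof. by rewrite /c4_vec map_rsubmx. Qed.

Lemma conj_c4_vec_sq (z : C4 R) :
  c4_vec_sq (map_mx Num.conj z) = (c4_vec_sq z)^*.
Proof.
rewrite /c4_vec_sq conj_c4_vec rmorph_sum; apply: eq_bigr => j _.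
by rewrite mxE rmorphXn.
Qed.

Lemma c4_vec_sq_ge0 (z : C4 R) : map_mx Num.conj z = z -> 0 <= c4_vec_sq z.
Proof.
move=> zR; apply: sumr_ge0 => j _; rewrite -realEsqr; apply/CrealP.
by rewrite -{2}zR conj_c4_vec [RHS]mxE.
Qed.

Lemma continuous_at_c4_scal (F : C -> C4 R) z :
  continuous_at z F -> continuous_at z (fun y => c4_scal (F y)).
Proof.
move=> Fz; have -> : (fun y => c4_scal (F y)) = (fun y => F y 0 (lshift 3 0)).
  by apply/funext => y; rewrite /c4_scal mxE.
exact: (continuous_at_comp Fz (@coord_continuous C _ _ _ _ _)).
Qed.

Lemma continuous_at_c4_vec (F : C -> C4 R) z j :
  continuous_at z F -> continuous_at z (fun y => c4_vec (F y) 0 j).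
Proof.
move=> Fz; have -> : (fun y => c4_vec (F y) 0 j) = (fun y => F y 0 (rshift 1 j)).
  by apply/funext => y; rewrite /c4_vec mxE.
exact: (continuous_at_comp Fz (@coord_continuous C _ _ _ _ _)).
Qed.

Lemma continuous_at_c4_vec_sq (F : C -> C4 R) z :
  continuous_at z F -> continuous_at z (fun y => c4_vec_sq (F y)).
Proof.
move=> Fz; have -> : (fun y => c4_vec_sq (F y)) = (fun y =>
    c4_vec (F y) 0 ord0 ^+ 2 + c4_vec (F y) 0 (lift ord0 ord0) ^+ 2 +
    c4_vec (F y) 0 (lift ord0 (lift ord0 ord0)) ^+ 2).
  by apply/funext => y; rewrite /c4_vec_sq !big_ord_recl big_ord0 addr0 addrA.
have sq j : continuous_at z (fun y => c4_vec (F y) 0 j ^+ 2).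
  by apply: continuous_atX; exact: continuous_at_c4_vec.
exact: (continuous_atD (continuous_atD (sq _) (sq _)) (sq _)).
Qed.

Lemma continuous_at_row (g l : C -> C) (F : C -> C4 R) z :
  continuous_at z g -> continuous_at z l -> continuous_at z F ->
  continuous_at z (fun y => row_mx (g y)%:M (l y *: c4_vec (F y)) : C4 R).
Proof.
move=> gz lz Fz; apply: continuous_at_mx => i j; rewrite (ord1 i).
case: (split_ordP j) => j' ->.
  rewrite (_ : (fun y => _) = g); first exact: gz.
  by apply/funext => y; rewrite row_mxEl mxE (ord1 j') eqxx.
rewrite (_ : (fun y => _) = (fun y => l y * c4_vec (F y) 0 j')); last first.
  by apply/funext => y; rewrite row_mxEr mxE.
by apply: (continuous_atM lz); exact: continuous_at_c4_vec.
Qed.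

End Stem.

Theorem theorem6p11 (R : realType) (U : set R[i]) (hU : admissible_domain U)
    (k : nat) (hk : (1 <= k)%N) (F : R[i] -> C4 R)
    (hFc : {within U, continuous F}) (hFO : F @` U `<=` Omega (R := R))
    (hF : is_stem U F) :
  exists G : 'I_k -> R[i] -> C4 R,
    [/\ (forall i, {within U, continuous (G i)}),
        (forall i z, U z -> sigma k (G i z) = F z),
        (forall i, is_stem U (G i)) &
        (forall i j, i != j -> exists2 z, U z & G i z <> G j z)].
Proof.
have Uo := admissible_open hU.
have Uconj z : U z -> U z^* by exact: admissible_conj.
have Fc z : U z -> continuous_at z F.
  by move=> Uz; move: hFc; rewrite continuous_open_subspace//; apply; rewrite inE.
have FO z : U z -> Omega (F z) by move=> Uz; apply: hFO; exists z.
have FJ z : U z -> F z^* = map_mx Num.conj (F z).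
  by move=> Uz; rewrite -(hF _ (Uconj _ Uz)) /T_op conjCK.
have [r rP] : exists r : R[i] -> R[i], forall z, U z ->
    [/\ continuous_at z r, r z ^+ 2 = c4_vec_sq (F z) & r z^* = (r z)^*].
  apply: symmetric_sqrt hU _ _ _ _ => z Uz.
  - exact/continuous_at_c4_vec_sq/Fc.
  - by have [] := FO z Uz.
  - by rewrite FJ// conj_c4_vec_sq.
  - by move=> zR; apply: c4_vec_sq_ge0; rewrite -FJ// zR.
(* Conjugation exchanges the two coordinates of [F] in [C * C], so a root
   [alpha] of the first determines the symmetric choice [beta] for the second. *)
pose a z := c4_scal (F z) + 'i * r z.
have aJ z : U z -> (a z^*)^* = c4_scal (F z) - 'i * r z.
  move=> Uz; have [_ _ rJ] := rP z Uz.
  by rewrite /a rmorphD rmorphM /= conjCi rJ conjCK FJ// conj_c4_scal conjCK mulNr.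
have ac z : U z -> continuous_at z a.
  move=> Uz; have [rc _ _] := rP z Uz.
  apply: continuous_atD; first exact/continuous_at_c4_scal/Fc.
  by apply: continuous_atM rc; exact: continuous_at_cst.
have a0 z : U z -> a z != 0.
  move=> Uz; have [_ rk _] := rP z Uz; have [_ + _] := FO z Uz.
  have -> : c4_scal (F z) ^+ 2 + c4_vec_sq (F z) = a z * (c4_scal (F z) - 'i * r z).
    rewrite -rk /a -[r z ^+ 2]mul1r -[1]opprK -sqrCi; ring.
  by rewrite mulf_eq0 negb_or => /andP[].
have r0 z : U z -> r z != 0.
  move=> Uz; have [_ rk _] := rP z Uz; have [+ _ _] := FO z Uz.
  by rewrite -rk; apply: contraNneq => ->; rewrite expr0n.
have [rho rhoP] := root_on_admissible hk hU ac a0.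
have [zeta [zeta_inj zetak]] := unity_roots R[i] hk.
pose alpha i z := zeta i * rho z.
pose beta i z := (alpha i z^*)^*.
have alphak i z : U z -> alpha i z ^+ k = c4_scal (F z) + 'i * r z.
  by move=> Uz; have [_ e] := rhoP z Uz; rewrite exprMn zetak mul1r e.
have betak i z : U z -> beta i z ^+ k = c4_scal (F z) - 'i * r z.
  by move=> Uz; rewrite -rmorphXn /= alphak ?aJ//; exact: Uconj.
pose g i z := (alpha i z + beta i z) / 2.
pose l i z := (alpha i z - beta i z) / (2 * 'i * r z).
have alphac i z : U z -> continuous_at z (alpha i).
  move=> Uz; have [e _] := rhoP z Uz.
  by apply: continuous_atM e; exact: continuous_at_cst.
have betac i z : U z -> continuous_at z (beta i).
  move=> Uz.
  exact: (continuous_at_comp (continuous_at_comp (@continuous_conj R z)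
           (alphac i _ (Uconj _ Uz))) (@continuous_conj R _)).
have dr0 z : U z -> 2 * 'i * r z != 0.
  by move=> Uz; rewrite !mulf_neq0 ?pnatr_eq0 ?neq0Ci ?r0.
exists (fun i z => row_mx (g i z)%:M (l i z *: c4_vec (F z))); split.
- move=> i; rewrite continuous_open_subspace// => z /[!inE] Uz.
  have [rc _ _] := rP z Uz.
  apply: continuous_at_row (Fc z Uz).
    apply: continuous_atM; last exact: continuous_at_cst.
    by apply: continuous_atD; [exact: alphac|exact: betac].
  apply: continuous_atM.
    by apply: continuous_atB; [exact: alphac|exact: betac].
  apply: continuous_atV; first exact: dr0.
  by apply: continuous_atM rc; exact: continuous_at_cst.
- move=> i z Uz; have [_ rk _] := rP z Uz.
  by apply: sigma_root; [exact: rk|exact: r0|exact: alphak|exact: betak].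
- move=> i z Uz; have [_ _ rJ] := rP z Uz.
  rewrite /T_op map_row_mx map_scalar_mx map_mxZ FJ// conj_c4_vec.
  have cvK : map_mx Num.conj (map_mx Num.conj (c4_vec (F z))) = c4_vec (F z).
    by apply/matrixP => i' j'; rewrite !mxE conjCK.
  have bJ : (beta i z^*)^* = alpha i z by rewrite /beta !conjCK.
  have gJ : (g i z^*)^* = g i z.
    by rewrite /g fmorph_div rmorphD /= bJ conjC_nat addrC.
  have lJ : (l i z^*)^* = l i z.
    by rewrite /l conj_half_difference bJ rJ conjCK.
  by rewrite cvK /= gJ lJ.
- move=> i j ij; have [z Uz] := admissible_nonempty hU; exists z => // e.
  have ge : g i z = g j z by have := congr1 (@c4_scal R) e; rewrite !c4_scal_row.
  have v0 : c4_vec (F z) != 0.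
    have [+ _ _] := FO z Uz; apply: contraNneq => v0.
    by rewrite /c4_vec_sq big1// => j' _; rewrite v0 mxE expr0n.
  have le : l i z = l j z.
    have := congr1 (@c4_vec R) e; rewrite !c4_vec_row => /eqP.
    by rewrite -subr_eq0 -scalerBl scaler_eq0 (negPf v0) orbF subr_eq0 => /eqP.
  have alphaE i' : alpha i' z = g i' z + 'i * r z * l i' z.
    by rewrite /g /l; field; rewrite neq0Ci r0.
  have : alpha i z = alpha j z by rewrite !alphaE ge le.
  have rho0 : rho z != 0.
    have [_ e'] := rhoP z Uz; have := a0 z Uz; rewrite -e'.
    by apply: contraNneq => ->; rewrite expr0n gtn_eqF.
  by move=> /(mulIf rho0)/zeta_inj/eqP; apply/negP.
Qed.
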